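(* Let $(M,d)$ be a complete geodesic space which is Busemann convex, i.e. for all geodesics $\gamma,\eta:[0,1]\to M$ with $\gamma_0=\eta_0$ it holds $d(\gamma_{1/2},\eta_{1/2})\le \tfrac12 d(\gamma_1,\eta_1)$. Then the following three properties are equivalent: (SO) For all geodesics $\gamma,\eta:[0,1]\to M$ with $\gamma_0=\eta_0$ it holds $\gamma\perp_{\gamma_0}\eta$ if and only if $\eta\perp_{\gamma_0}\gamma$. (A) Whenever $\gamma:[0,1]\to M$ is a geodesic and $x\in M$, then for all $t\in[0,1]$ and all $x_C\in\pi_\gamma(x)$ it holds $d(x_C,\gamma_t)\le d(x,\gamma_t)$. (NE) Whenever $C\subset M$ is a closed convex set and $x,y\in M$, then for all $x_C\in\pi_C(x)$ and $y_C\in\pi_C(y)$ it holds $d(x_C,y_C)\le d(x,y)$.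
   Context: A geodesic is a map $\gamma:[0,1]\to M$ with $d(\gamma_t,\gamma_s)=|t-s|\,d(\gamma_0,\gamma_1)$; $(M,d)$ is geodesic if any two points are joined by a geodesic. For geodesics $\gamma,\eta$ with common starting point $p=\gamma_0=\eta_0$, write $\gamma\perp_p\eta$ (''$\gamma$ is orthogonal to $\eta$'') if $d(p,\gamma_t)\le d(\eta_s,\gamma_t)$ for all $t,s\in[0,1]$. For $C\subset M$ and $x\in M$, $\pi_C(x)=\{y\in C: d(x,y)=\inf_{z\in C}d(x,z)\}$ is the set of nearest points; $\pi_\gamma$ means $\pi_{\gamma([0,1])}$. A set $C$ is convex if every geodesic joining two points of $C$ lies entirely in $C$. *)

(* Defs.v *)
From Stdlib Require Import Reals Lra.
Open Scope R_scope.

Section MetricDefs.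
Context {M : Type} (d : M -> M -> R).

Definition is_metric : Prop :=
  (forall x y, 0 <= d x y) /\
  (forall x y, d x y = 0 <-> x = y) /\
  (forall x y, d x y = d y x) /\
  (forall x y z, d x z <= d x y + d y z).

Definition cauchy_seq (u : nat -> M) : Prop :=
  forall eps, 0 < eps -> exists N, forall m n, (N <= m)%nat -> (N <= n)%nat -> d (u m) (u n) < eps.

Definition seq_converges (u : nat -> M) (x : M) : Prop :=
  forall eps, 0 < eps -> exists N, forall n, (N <= n)%nat -> d (u n) x < eps.

Definition complete : Prop :=
  forall u, cauchy_seq u -> exists x, seq_converges u x.

Definition in01 (t : R) : Prop := 0 <= t <= 1.

(* a geodesic [0,1] -> M, represented by a function R -> M whose values
   outside [0,1] are irrelevant *)
Definition geodesic (g : R -> M) : Prop :=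
  forall t s, in01 t -> in01 s -> d (g t) (g s) = Rabs (t - s) * d (g 0) (g 1).

Definition geodesic_space : Prop :=
  forall x y, exists g, geodesic g /\ g 0 = x /\ g 1 = y.

Definition busemann_convex : Prop :=
  forall g e, geodesic g -> geodesic e -> g 0 = e 0 ->
    d (g (1/2)) (e (1/2)) <= 1/2 * d (g 1) (e 1).

Definition orth (p : M) (g e : R -> M) : Prop :=
  forall t s, in01 t -> in01 s -> d p (g t) <= d (e s) (g t).

Definition nearest (C : M -> Prop) (x y : M) : Prop :=
  C y /\ forall z, C z -> d x y <= d x z.

Definition image01 (g : R -> M) : M -> Prop :=
  fun y => exists t, in01 t /\ g t = y.

Definition closed_set (C : M -> Prop) : Prop :=
  forall x, ~ C x -> exists eps, 0 < eps /\ forall y, d x y < eps -> ~ C y.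

Definition convex_set (C : M -> Prop) : Prop :=
  forall g, geodesic g -> C (g 0) -> C (g 1) -> forall t, in01 t -> C (g t).

Definition prop_SO : Prop :=
  forall g e, geodesic g -> geodesic e -> g 0 = e 0 ->
    (orth (g 0) g e <-> orth (g 0) e g).

Definition prop_A : Prop :=
  forall g x, geodesic g -> forall t xC, in01 t -> nearest (image01 g) x xC ->
    d xC (g t) <= d x (g t).

Definition prop_NE : Prop :=
  forall C, closed_set C -> convex_set C -> forall x y xC yC,
    nearest C x xC -> nearest C y yC -> d xC yC <= d x y.

End MetricDefs.

(* Main.v *)
(** The substantial implication is (A) => (NE). Let [p], [q] be nearest points in [C]
    to [x], [y]. Pulling the farther of [x], [y] down towards [C] does not increase
    [d x y] by (A), so [x] and [y] may be taken at the same distance from [C]. Follow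
    the geodesics from [p] to [x] and from [q] to [y] at a common height [a] to points
    [x_a], [y_a]. If the midpoint of [x_a], [y_a] is closer to [C] than [a], pulling
    both points down to its height does not increase their distance, by (A). Otherwise
    the quadrilateral is a flat rectangle, in the sense that its diagonals have the
    same midpoint, and then [x_(a/2)], [y_(a/2)] are no farther apart than [x_a], [y_a].
    Hence the least height at which the distance is at most [d x y] is [0]. *)
Require Import Defs.
From Stdlib Require Import Reals Lra.
Open Scope R_scope.

Section BusemannSpace.
Context {M : Type} (d : M -> M -> R).
Context (Hmet : is_metric d).

(** * Geodesics in a metric space *)

Lemma d_ge0 x y : 0 <= d x y.
Proof. apply Hmet. Qed.

Lemma d_self x : d x x = 0.
Proof. now apply Hmet. Qed.

Lemma d_eq0 x y : d x y <= 0 -> x = y.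
Proof. intros H. apply Hmet. pose proof (d_ge0 x y). lra. Qed.

Lemma d_sym x y : d x y = d y x.
Proof. apply Hmet. Qed.

Lemma d_tri x y z : d x z <= d x y + d y z.
Proof. apply Hmet. Qed.

Lemma d_lip x y z : Rabs (d x y - d x z) <= d y z.
Proof.
  pose proof (d_tri x y z); pose proof (d_tri x z y).
  rewrite (d_sym z y) in *. apply Rabs_le; lra.
Qed.

Lemma in01_between a b t : in01 a -> in01 b -> in01 t -> in01 (a + t * (b - a)).
Proof. unfold in01. intros. nra. Qed.

Lemma geodesic_sub g a b : geodesic d g -> in01 a -> in01 b ->
  geodesic d (fun t => g (a + t * (b - a))).
Proof.
  intros Hg Ha Hb t s Ht Hs.
  assert (in01 0 /\ in01 1) as [] by (unfold in01; lra).
  rewrite (Hg (a + t * (b - a)) (a + s * (b - a))),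
    (Hg (a + 0 * (b - a)) (a + 1 * (b - a))) by auto using in01_between.
  replace (a + t * (b - a) - (a + s * (b - a))) with ((t - s) * (b - a)) by ring.
  replace (a + 0 * (b - a) - (a + 1 * (b - a))) with (- (b - a)) by ring.
  rewrite Rabs_mult, Rabs_Ropp. ring.
Qed.

Lemma geodesic_rev g : geodesic d g -> geodesic d (fun t => g (1 - t)).
Proof.
  intros Hg t s Ht Hs. unfold in01 in *.
  rewrite (Hg (1 - t) (1 - s)), (Hg (1 - 0) (1 - 1)) by (unfold in01; lra).
  replace (1 - t - (1 - s)) with (- (t - s)) by ring.
  replace (1 - 0 - (1 - 1)) with 1 by ring.
  rewrite Rabs_Ropp, Rabs_R1. ring.
Qed.

Lemma geodesic_d_start g t : geodesic d g -> in01 t -> d (g 0) (g t) = t * d (g 0) (g 1).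
Proof.
  intros Hg Ht. unfold in01 in Ht. rewrite Hg by (unfold in01; lra).
  replace (0 - t) with (- t) by ring. rewrite Rabs_Ropp, Rabs_pos_eq; lra.
Qed.

Lemma geodesic_d_end g t : geodesic d g -> in01 t -> d (g t) (g 1) = (1 - t) * d (g 0) (g 1).
Proof.
  intros Hg Ht. unfold in01 in Ht. rewrite Hg by (unfold in01; lra).
  replace (t - 1) with (- (1 - t)) by ring. rewrite Rabs_Ropp, Rabs_pos_eq; lra.
Qed.

Lemma geodesic_concat u v m : geodesic_space d ->
  d u v = 2 * d u m -> d m v = d u m ->
  exists g, geodesic d g /\ g 0 = u /\ g 1 = v /\ g (1 / 2) = m.
Proof.
  intros Hgs Huv Hmv.
  destruct (Hgs u m) as (g1 & G1 & <- & E1).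
  destruct (Hgs m v) as (g2 & G2 & E2 & <-).
  set (g := fun t => if Rle_dec t (1 / 2) then g1 (2 * t) else g2 (2 * t - 1)).
  assert (Hlo : forall t, t <= 1 / 2 -> g t = g1 (2 * t))
    by (intros t Ht; unfold g; destruct (Rle_dec t (1 / 2)); [reflexivity | lra]).
  assert (Hhi : forall t, 1 / 2 < t -> g t = g2 (2 * t - 1))
    by (intros t Ht; unfold g; destruct (Rle_dec t (1 / 2)); [lra | reflexivity]).
  assert (H0 : g 0 = g1 0) by (rewrite Hlo by lra; f_equal; lra).
  assert (H1 : g 1 = g2 1) by (rewrite Hhi by lra; f_equal; lra).
  (* The path through [m] gives the upper bound; anything shorter would bring [g1 0] and [g2 1]
     closer than [2 * d u m]. *)
  assert (Hcross : forall t s, 0 <= t <= 1 / 2 -> 1 / 2 < s <= 1 ->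
            d (g t) (g s) = (s - t) * d (g1 0) (g2 1)).
  { intros t s Ht Hs. rewrite Hlo, Hhi by lra.
    assert (T : in01 (2 * t)) by (unfold in01; lra).
    assert (S : in01 (2 * s - 1)) by (unfold in01; lra).
    pose proof (geodesic_d_start g1 _ G1 T) as A1.
    pose proof (geodesic_d_end g1 _ G1 T) as A2.
    pose proof (geodesic_d_start g2 _ G2 S) as B1.
    pose proof (geodesic_d_end g2 _ G2 S) as B2.
    rewrite E1 in *. rewrite E2 in *.
    pose proof (d_tri (g1 (2 * t)) m (g2 (2 * s - 1))).
    pose proof (d_tri (g1 0) (g1 (2 * t)) (g2 1)).
    pose proof (d_tri (g1 (2 * t)) (g2 (2 * s - 1)) (g2 1)).
    rewrite Hmv in *. rewrite Huv in *. nra. }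
  exists g. repeat split; auto.
  - intros t s Ht Hs. rewrite H0, H1. unfold in01 in *.
    destruct (Rle_dec t (1 / 2)), (Rle_dec s (1 / 2)).
    + rewrite !Hlo, G1, E1, Huv by (auto; unfold in01; lra).
      replace (2 * t - 2 * s) with (2 * (t - s)) by ring.
      rewrite Rabs_mult, (Rabs_pos_eq 2) by lra. ring.
    + rewrite Hcross, Rabs_minus_sym, Rabs_pos_eq by lra. reflexivity.
    + rewrite d_sym, Hcross, Rabs_pos_eq by lra. reflexivity.
    + rewrite !Hhi, G2, E2, Hmv, Huv by (unfold in01; lra).
      replace (2 * t - 1 - (2 * s - 1)) with (2 * (t - s)) by ring.
      rewrite Rabs_mult, (Rabs_pos_eq 2) by lra. ring.
  - rewrite Hlo by lra. rewrite <- E1. f_equal. lra.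
Qed.

(** By compactness of the parameter interval the distance from [x] to the curve is attained, so it
    is positive off the curve and serves as the radius. *)
Lemma image01_closed g : geodesic d g -> Defs.closed_set d (image01 g).
Proof.
  intros Hg x Hx.
  (* Clamping to [0,1] gives two-sided continuity at the endpoints, beyond which [g] is
     arbitrary. *)
  set (c := fun t => Rmax 0 (Rmin 1 t)).
  assert (Hc01 : forall t, in01 (c t)).
  { intros t. unfold c, in01, Rmax, Rmin.
    destruct (Rle_dec 1 t), (Rle_dec 0 _); lra. }
  assert (Hc : forall t, in01 t -> c t = t).
  { intros t Ht. unfold c, in01, Rmax, Rmin in *.
    destruct (Rle_dec 1 t), (Rle_dec 0 _); lra. }
  assert (Hclip : forall t s, Rabs (c t - c s) <= Rabs (t - s)).
  { intros t s. unfold c, Rmax, Rmin.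
    destruct (Rle_dec 1 t), (Rle_dec 0 _), (Rle_dec 1 s), (Rle_dec 0 _);
      unfold Rabs; repeat destruct Rcase_abs; lra. }
  set (f := fun t => d x (g (c t))).
  assert (Hcont : forall t, 0 <= t <= 1 -> continuity_pt f t).
  { intros t _ eps Heps.
    pose proof (d_ge0 (g 0) (g 1)) as HD.
    exists (eps / (d (g 0) (g 1) + 1)). split.
    - apply Rdiv_lt_0_compat; lra.
    - intros s [_ Hs]. simpl in *. unfold Rdist in *. unfold f.
      eapply Rle_lt_trans; [apply d_lip|].
      rewrite Hg by auto.
      pose proof (Hclip s t). pose proof (Rabs_pos (s - t)).
      apply (Rmult_lt_compat_r (d (g 0) (g 1) + 1)) in Hs; [|lra].
      unfold Rdiv in Hs. rewrite Rmult_assoc, Rinv_l in Hs by lra. nra. }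
  destruct (continuity_ab_min f 0 1 Rle_0_1 Hcont) as (m & Hmin & Hm).
  exists (f m). split.
  - destruct (Rle_lt_dec (f m) 0) as [H|H]; [|exact H].
    exfalso. apply Hx. exists (c m). split; [auto|].
    symmetry. now apply d_eq0.
  - intros y Hy (t & Ht & <-).
    specialize (Hmin t Ht). unfold f at 2 in Hmin. rewrite Hc in Hmin by exact Ht. lra.
Qed.

(** * Symmetry of orthogonality and property (A) *)

(** Orthogonality of [g] to [e] means that the common start is a nearest point of [e] to every
    [g s], which is the situation of (A). *)
Lemma A_implies_SO : prop_A d -> prop_SO d.
Proof.
  intros HA.
  assert (H : forall g e, geodesic d g -> geodesic d e -> g 0 = e 0 ->
            orth d (g 0) g e -> orth d (g 0) e g).
  { intros g e Hg He E0 Ho t s Ht Hs.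
    apply (HA e (g s) He t); [exact Ht|]. split.
    - exists 0. split; [unfold in01; lra | auto].
    - intros z (u & Hu & <-). rewrite (d_sym (g s)), (d_sym (g s)).
      now apply Ho. }
  intros g e Hg He E0. split; [now apply H|].
  rewrite E0. apply H; auto.
Qed.

Context (Hgs : geodesic_space d).

Lemma SO_implies_A : prop_SO d -> prop_A d.
Proof.
  intros HSO g x Hg t xC Ht [(t0 & Ht0 & <-) Hnear].
  destruct (Hgs (g t0) x) as (e & He & E0 & <-).
  (* (SO) needs a common starting point, so [g] is restarted at [g t0] and run, possibly backwards,
     to [g t]. *)
  set (k := fun u => g (t0 + u * (t - t0))).
  assert (Hk : geodesic d k) by now apply geodesic_sub.
  assert (K0 : k 0 = g t0) by (unfold k; f_equal; ring).
  assert (K1 : k 1 = g t) by (unfold k; f_equal; ring).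
  (* The foot [e 0] of [e 1] is also a nearest point to every [e s] on the way. *)
  assert (H : orth d (e 0) e k).
  { intros s u Hs Hu.
    assert (Hz : d (e 1) (e 0) <= d (e 1) (k u)).
    { rewrite E0. apply Hnear. exists (t0 + u * (t - t0)). split; [|reflexivity].
      now apply in01_between. }
    pose proof (geodesic_d_start e s He Hs).
    pose proof (geodesic_d_end e s He Hs).
    pose proof (d_tri (e 1) (e s) (k u)).
    rewrite (d_sym (e 1) (e 0)), (d_sym (e 1) (e s)), (d_sym (k u) (e s)) in *. lra. }
  apply HSO in H; [|auto|auto|congruence].
  rewrite <- E0, <- K1. apply H; unfold in01; lra.
Qed.

(** * Convexity of the distance and uniqueness of geodesics *)

Context (Hbus : busemann_convex d).

(** The diagonal from [g 0] to [e 1] cuts the quadrilateral into two triangles, and Busemann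
    convexity applies to each. *)
Lemma midpoint_convex g e : geodesic d g -> geodesic d e ->
  d (g (1 / 2)) (e (1 / 2)) <= (d (g 0) (e 0) + d (g 1) (e 1)) / 2.
Proof.
  intros Hg He.
  destruct (Hgs (g 0) (e 1)) as (k & Hk & K0 & K1).
  pose proof (Hbus g k Hg Hk (eq_sym K0)) as H1.
  pose proof (Hbus _ _ (geodesic_rev k Hk) (geodesic_rev e He)) as H2.
  simpl in H2. rewrite !Rminus_0_r, !Rminus_diag in H2.
  replace (1 - 1 / 2) with (1 / 2) in H2 by lra.
  specialize (H2 K1). rewrite K0 in H2. rewrite K1 in H1.
  pose proof (d_tri (g (1 / 2)) (k (1 / 2)) (e (1 / 2))). lra.
Qed.

(* For [f t = d (g t) (e t)], midpoint convexity on [0, 2t] or [2t - 1, 1]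
   halves the excess [f - r]; as [f] is bounded, the excess is nonpositive. *)
Lemma quasiconvex g e r : geodesic d g -> geodesic d e ->
  d (g 0) (e 0) <= r -> d (g 1) (e 1) <= r ->
  forall t, in01 t -> d (g t) (e t) <= r.
Proof.
  intros Hg He H0 H1.
  set (K := d (g 0) (g 1) + d (e 0) (e 1)).
  assert (Hr : 0 <= r) by (pose proof (d_ge0 (g 0) (e 0)); lra).
  assert (HK : 0 <= K)
    by (unfold K; pose proof (d_ge0 (g 0) (g 1)); pose proof (d_ge0 (e 0) (e 1)); lra).
  assert (Hn : forall n t, in01 t -> d (g t) (e t) <= r + K * (1 / 2) ^ n).
  { induction n as [|n IH]; intros t Ht.
    - simpl.
      pose proof (geodesic_d_start g t Hg Ht). pose proof (geodesic_d_start e t He Ht).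
      pose proof (d_tri (g t) (g 0) (e t)). pose proof (d_tri (g 0) (e 0) (e t)).
      pose proof (d_ge0 (g 0) (g 1)). pose proof (d_ge0 (e 0) (e 1)).
      rewrite (d_sym (g t) (g 0)) in *. unfold in01, K in *. nra.
    - assert (Hsub : forall a b, in01 a -> in01 b -> t = a + 1 / 2 * (b - a) ->
                d (g t) (e t) <= (d (g a) (e a) + d (g b) (e b)) / 2).
      { intros a b Ha Hb ->.
        pose proof (midpoint_convex _ _ (geodesic_sub g a b Hg Ha Hb)
                      (geodesic_sub e a b He Ha Hb)) as H.
        simpl in H. replace (a + 0 * (b - a)) with a in H by ring.
        replace (a + 1 * (b - a)) with b in H by ring. exact H. }
      simpl. unfold in01 in *.
      destruct (Rle_dec t (1 / 2)).
      + specialize (Hsub 0 (2 * t) ltac:(lra) ltac:(lra) ltac:(lra)).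
        specialize (IH (2 * t) ltac:(lra)). lra.
      + specialize (Hsub (2 * t - 1) 1 ltac:(lra) ltac:(lra) ltac:(lra)).
        specialize (IH (2 * t - 1) ltac:(lra)). lra. }
  intros t Ht. apply Rnot_lt_le. intros Hlt.
  destruct (pow_lt_1_zero (1 / 2) ltac:(rewrite Rabs_pos_eq; lra)
              ((d (g t) (e t) - r) / (K + 1))) as (N & HN).
  { apply Rdiv_lt_0_compat; lra. }
  specialize (HN N (le_n _)).
  assert (Hp : 0 <= (1 / 2) ^ N) by (apply pow_le; lra).
  rewrite Rabs_pos_eq in HN by exact Hp.
  apply (Rmult_lt_compat_r (K + 1)) in HN; [|lra].
  unfold Rdiv at 2 in HN. rewrite Rmult_assoc, Rinv_l in HN by lra.
  specialize (Hn N t Ht). lra.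
Qed.

Lemma geodesic_unique g e : geodesic d g -> geodesic d e -> g 0 = e 0 -> g 1 = e 1 ->
  forall t, in01 t -> g t = e t.
Proof.
  intros Hg He E0 E1 t Ht. apply d_eq0.
  apply quasiconvex; auto; [rewrite E0 | rewrite E1]; rewrite d_self; lra.
Qed.

(** The triangle inequality turns all the bounds into equalities, so [m] and [m'] are midpoints of
    geodesics with the same endpoints. *)
Lemma midpoint_unique u v m m' r : r + r <= d u v ->
  d u m <= r -> d m v <= r -> d u m' <= r -> d m' v <= r -> m = m'.
Proof.
  intros Huv H1 H2 H3 H4.
  pose proof (d_tri u m v). pose proof (d_tri u m' v).
  destruct (geodesic_concat u v m Hgs) as (g & Hg & G0 & G1 & <-); [lra..|].
  destruct (geodesic_concat u v m' Hgs) as (e & He & E0 & E1 & <-); [lra..|].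
  apply geodesic_unique; auto; [congruence..| unfold in01; lra].
Qed.

Lemma image01_convex g : geodesic d g -> convex_set d (image01 g).
Proof.
  intros Hg e He (a & Ha & Ea) (b & Hb & Eb) t Ht.
  exists (a + t * (b - a)). split; [now apply in01_between|].
  apply (geodesic_unique (fun t => g (a + t * (b - a))) e); auto.
  - now apply geodesic_sub.
  - rewrite <- Ea. f_equal. ring.
  - rewrite <- Eb. f_equal. ring.
Qed.

(** * Property (A) and nonexpansive projections *)

(** The image of [g] is closed and convex, and [g t] is its own nearest point there. *)
Lemma NE_implies_A : prop_NE d -> prop_A d.
Proof.
  intros HNE g x Hg t xC Ht Hx.
  apply (HNE (image01 g)); auto using image01_closed, image01_convex.
  split; [now exists t|].
  intros z _. rewrite d_self. apply d_ge0.
Qed.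

(* Every point of the geodesic from [e tau] to [o] is within [tau * d (e 0) (e 1)]
   of [C], so [e tau] is its nearest point to [e 1], and (A) applies to it. *)
Lemma A_pull_down C e o w tau : prop_A d -> convex_set d C -> geodesic d e ->
  nearest d C (e 1) (e 0) -> in01 tau -> C w -> d o w <= tau * d (e 0) (e 1) ->
  d (e tau) o <= d (e 1) o.
Proof.
  intros HA HC He [Hp Hnear] Htau Hw Ho.
  destruct (Hgs (e tau) o) as (k & Hk & K0 & <-).
  destruct (Hgs (e 0) w) as (l & Hl & L0 & <-).
  apply (HA k (e 1) Hk 1); [unfold in01; lra|]. split.
  - exists 0. split; [unfold in01; lra | exact K0].
  - intros z (s & Hs & <-).
    assert (Hks : d (k s) (l s) <= tau * d (e 0) (e 1)).
    { apply quasiconvex; auto.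
      rewrite K0, L0, d_sym, geodesic_d_start by auto. lra. }
    assert (HCl : C (l s)) by (apply HC; auto; congruence).
    (* A point within [tau * d (e 0) (e 1)] of [C] is at least as far from [e 1] as [e tau] is. *)
    pose proof (Hnear _ HCl). pose proof (d_tri (e 1) (k s) (l s)).
    rewrite (d_sym (e 1) (e tau)), geodesic_d_end by auto.
    rewrite (d_sym (e 1) (e 0)) in *. lra.
Qed.

(* If the midpoints [g (1/2)] and [k (1/2)] of the bottom and top sides are at distance
   at least the common height, then both diagonals have as midpoint the midpoint of
   [g (1/2)] and [k (1/2)], and it is at distance at most [d (e 1) (f 1) / 2] from
   [e (1/2)] and from [f (1/2)]. *)
Lemma A_descent_step C e f : prop_A d -> convex_set d C -> geodesic d e -> geodesic d f ->
  nearest d C (e 1) (e 0) -> nearest d C (f 1) (f 0) ->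
  d (e 0) (e 1) = d (f 0) (f 1) -> 0 < d (e 0) (e 1) ->
  exists t, 0 <= t < 1 /\ d (e t) (f t) <= d (e 1) (f 1).
Proof.
  intros HA HC He Hf Ne Nf Ha Hpos.
  destruct (Hgs (e 0) (f 0)) as (g & Hg & G0 & G1).
  destruct (Hgs (e 1) (f 1)) as (k & Hk & K0 & K1).
  assert (H12 : in01 (1 / 2)) by (unfold in01; lra).
  destruct (Rlt_le_dec (d (k (1 / 2)) (g (1 / 2))) (d (e 0) (e 1))) as [Hlt|Hge].
  (* This [tau] makes the height [tau * a] equal to the distance from [k (1 / 2)] to the point
     [g (1 / 2)] of [C]. *)
  - set (a := d (e 0) (e 1)) in *. set (tau := d (k (1 / 2)) (g (1 / 2)) / a).
    assert (Etau : tau * a = d (k (1 / 2)) (g (1 / 2))) by (unfold tau; field; lra).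
    pose proof (d_ge0 (k (1 / 2)) (g (1 / 2))).
    assert (Htau : 0 <= tau < 1) by nra.
    assert (Hw : C (g (1 / 2))).
    { apply HC; auto; [rewrite G0; apply Ne | rewrite G1; apply Nf]. }
    assert (He' : d (e tau) (k (1 / 2)) <= d (e 1) (k (1 / 2))).
    { apply (A_pull_down C) with (g (1 / 2)); auto; [unfold in01; lra | fold a; lra]. }
    assert (Hf' : d (f tau) (k (1 / 2)) <= d (f 1) (k (1 / 2))).
    { apply (A_pull_down C) with (g (1 / 2)); auto; [unfold in01; lra | rewrite <- Ha; lra]. }
    exists tau. split; [lra|].
    pose proof (geodesic_d_start k _ Hk H12). pose proof (geodesic_d_end k _ Hk H12).
    rewrite K0, K1 in *. rewrite (d_sym (f tau)), (d_sym (f 1)) in Hf'.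
    pose proof (d_tri (e tau) (k (1 / 2)) (f tau)). lra.
  - destruct (Hgs (e 0) (f 1)) as (n & Hn & N0 & N1).
    destruct (Hgs (f 0) (e 1)) as (n' & Hn' & N0' & N1').
    pose proof (Hbus g n Hg Hn ltac:(congruence)) as B1.
    pose proof (Hbus e n He Hn ltac:(congruence)) as B2.
    pose proof (Hbus f n' Hf Hn' ltac:(congruence)) as B3.
    pose proof (midpoint_convex n k Hn Hk) as B4.
    pose proof (midpoint_convex n' _ Hn' (geodesic_rev g Hg)) as B5.
    pose proof (midpoint_convex n' _ Hn' (geodesic_rev k Hk)) as B6.
    simpl in B5, B6. rewrite Rminus_0_r, Rminus_diag in B5, B6.
    replace (1 - 1 / 2) with (1 / 2) in B5, B6 by lra.
    rewrite ?N0, ?N1, ?N0', ?N1', ?G0, ?G1, ?K0, ?K1, ?d_self in *.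
    (* [B1], [B4], [B5] and [B6] put both diagonal midpoints within half the height of [g (1 / 2)]
       and of [k (1 / 2)]. *)
    assert (E : n (1 / 2) = n' (1 / 2)).
    { rewrite (d_sym (k _)) in Hge. rewrite (d_sym (n' _) (g _)) in B5.
      rewrite (d_sym (e 1) (e 0)) in *.
      apply (midpoint_unique (g (1 / 2)) (k (1 / 2)) _ _ (d (e 0) (e 1) / 2)); lra. }
    exists (1 / 2). split; [lra|].
    rewrite E in B2. rewrite (d_sym (f (1 / 2))), (d_sym (f 1)) in B3.
    pose proof (d_tri (e (1 / 2)) (n' (1 / 2)) (f (1 / 2))). lra.
Qed.

Lemma nearest_sub C e t : geodesic d e -> nearest d C (e 1) (e 0) -> in01 t ->
  nearest d C (e t) (e 0).
Proof.
  intros He [H0 Hn] Ht. split; [exact H0|]. intros z Hz.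
  pose proof (Hn z Hz). pose proof (d_tri (e 1) (e t) z).
  rewrite (d_sym (e t) (e 0)), geodesic_d_start by auto.
  rewrite (d_sym (e 1) (e t)), geodesic_d_end in * by auto.
  rewrite (d_sym (e 1) (e 0)) in *. lra.
Qed.

(* The infimum of the closed set of [t] with [d (e t) (f t) <= d (e 1) (f 1)] must be
   [0], since [A_descent_step] applied below [t] yields a smaller element. *)
Lemma A_equal_height C e f : prop_A d -> convex_set d C -> geodesic d e -> geodesic d f ->
  nearest d C (e 1) (e 0) -> nearest d C (f 1) (f 0) ->
  d (e 0) (e 1) = d (f 0) (f 1) -> d (e 0) (f 0) <= d (e 1) (f 1).
Proof.
  intros HA HC He Hf Ne Nf Ha.
  pose proof (d_ge0 (e 0) (e 1)) as Hpos.
  (* Parameters are negated because [completeness] provides suprema. *)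
  set (S := fun u => in01 (- u) /\ d (e (- u)) (f (- u)) <= d (e 1) (f 1)).
  assert (Hb : bound S) by (exists 0; intros u [[Hu _] _]; lra).
  assert (Hne : exists u, S u).
  { exists (-1). unfold S. replace (- -1) with 1 by ring. split; [unfold in01; lra | lra]. }
  destruct (completeness S Hb Hne) as (m & Hub & Hlub).
  set (t := - m).
  assert (Hlow : forall u, in01 u -> d (e u) (f u) <= d (e 1) (f 1) -> t <= u).
  { intros u Hu Hd. assert (- u <= m); [|unfold t; lra].
    apply Hub. unfold S. now rewrite Ropp_involutive. }
  assert (Ht : in01 t).
  { split.
    - assert (m <= 0); [|unfold t; lra]. apply Hlub. intros u [[Hu _] _]. lra.
    - apply Hlow; [unfold in01; lra | lra]. }
  assert (HSt : d (e t) (f t) <= d (e 1) (f 1)).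
  { apply Rnot_lt_le. intros Hlt.
    set (a := d (e 0) (e 1)) in *.
    (* Changing the parameter by at most [eps] changes the distance by at most [2 * a * eps], less
       than its excess at [t]; hence [m - eps] would still bound [S]. *)
    set (eps := (d (e t) (f t) - d (e 1) (f 1)) / (2 * a + 1)).
    assert (Heps : 0 < eps) by (apply Rdiv_lt_0_compat; lra).
    assert (Eeps : eps * (2 * a + 1) = d (e t) (f t) - d (e 1) (f 1))
      by (unfold eps; field; lra).
    assert (H : m <= m - eps); [|lra].
    apply Hlub. intros u [Hu Hd]. apply Rnot_lt_le. intros Hmu.
    assert (Hut : u <= m) by (apply Hub; split; auto).
    pose proof (He t (- u) Ht Hu) as E1. pose proof (Hf t (- u) Ht Hu) as E2.
    fold a in E1. rewrite <- Ha in E2.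
    assert (HA1 : Rabs (t - - u) <= eps) by (apply Rabs_le; unfold t; lra).
    pose proof (d_tri (e t) (e (- u)) (f t)).
    pose proof (d_tri (e (- u)) (f (- u)) (f t)).
    rewrite (d_sym (f (- u)) (f t)) in *. nra. }
  (* The zero case covers both [t = 0] and constant geodesics. *)
  destruct (Req_dec (t * d (e 0) (e 1)) 0) as [E|E].
  - pose proof (geodesic_d_start e t He Ht) as E1.
    pose proof (geodesic_d_start f t Hf Ht) as E2. rewrite <- Ha in E2.
    rewrite (d_eq0 (e 0) (e t)), (d_eq0 (f 0) (f t)) by lra. exact HSt.
  - exfalso.
    assert (in01 0) by (unfold in01; lra).
    assert (E0 : forall h : R -> M, h (0 + 0 * (t - 0)) = h 0) by (intros; f_equal; ring).
    assert (E1 : forall h : R -> M, h (0 + 1 * (t - 0)) = h t) by (intros; f_equal; ring).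
    destruct (A_descent_step C (fun u => e (0 + u * (t - 0))) (fun u => f (0 + u * (t - 0))))
      as (u & Hu & Hd); auto using geodesic_sub; rewrite ?E0, ?E1 in *;
      auto using nearest_sub; rewrite ?geodesic_d_start by auto.
    + now rewrite (geodesic_d_start f), Ha.
    + pose proof (Rmult_le_pos t _ (proj1 Ht) Hpos). lra.
    + assert (Htpos : 0 < t).
      { destruct Ht as [[Ht|Ht] _]; [exact Ht|]. rewrite <- Ht in E. lra. }
      assert (t <= 0 + u * (t - 0)); [|nra].
      apply Hlow; [unfold in01 in *; nra | lra].
Qed.

Lemma A_implies_NE : prop_A d -> prop_NE d.
Proof.
  intros HA.
  assert (H : forall C, convex_set d C -> forall x y p q, nearest d C x p -> nearest d C y q ->
            d q y <= d p x -> d p q <= d x y).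
  { intros C HC x y p q Hp Hq Hle.
    destruct (Hgs p x) as (e & He & <- & <-).
    destruct (Hgs q y) as (f & Hf & <- & <-).
    pose proof (d_ge0 (f 0) (f 1)) as Hf0.
    (* If [e] is constant then so is [f] by [Hle], and [tau = 0] works. *)
    assert (Htau : exists tau, in01 tau /\ tau * d (e 0) (e 1) = d (f 0) (f 1)).
    { destruct (Req_dec (d (e 0) (e 1)) 0) as [E|E].
      - exists 0. unfold in01; lra.
      - exists (d (f 0) (f 1) / d (e 0) (e 1)).
        assert (E' : d (f 0) (f 1) / d (e 0) (e 1) * d (e 0) (e 1) = d (f 0) (f 1))
          by (field; lra).
        split; [unfold in01; nra | exact E']. }
    destruct Htau as (tau & Htau & Etau).
    assert (H1 : d (e tau) (f 1) <= d (e 1) (f 1)).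
    { apply (A_pull_down C) with (f 0); auto; [apply Hq|]. rewrite d_sym. lra. }
    assert (in01 0) by (unfold in01; lra).
    assert (E0 : forall h : R -> M, h (0 + 0 * (tau - 0)) = h 0) by (intros; f_equal; ring).
    assert (E1 : forall h : R -> M, h (0 + 1 * (tau - 0)) = h tau) by (intros; f_equal; ring).
    pose proof (A_equal_height C (fun u => e (0 + u * (tau - 0))) f HA HC
                  (geodesic_sub e _ _ He H Htau) Hf) as H2.
    simpl in H2. rewrite !E0, !E1, geodesic_d_start in H2 by auto.
    specialize (H2 (nearest_sub C e tau He Hp Htau) Hq Etau). lra. }
  intros C _ HC x y p q Hp Hq.
  destruct (Rle_dec (d q y) (d p x)).
  - now apply (H C).
  - rewrite (d_sym p q), (d_sym x y). apply (H C); auto. lra.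
Qed.

End BusemannSpace.

Theorem theorem1 (M : Type) (d : M -> M -> R) :
  is_metric d -> complete d -> geodesic_space d -> busemann_convex d ->
  (prop_SO d <-> prop_A d) /\ (prop_A d <-> prop_NE d).
Proof.
  intros Hmet _ Hgs Hbus. split; split.
  - now apply SO_implies_A.
  - now apply A_implies_SO.
  - now apply A_implies_NE.
  - now apply NE_implies_A.
Qed.
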